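(* Let $\mathcal{N}$ be an admissible algebra with admissible projections $\pi$, $\tilde\pi$. Then there exists $a\in\mathcal{N}$ with $S_{\tilde\pi}=S_\pi+a$.
   Context: All algebras are over $\mathbb{C}$. A finite-dimensional commutative associative algebra $\mathcal{N}$ is nilpotent if $\mathcal{N}^{\nu+1}=0$ for some $\nu\ge 0$, where $\mathcal{N}^1:=\mathcal{N}$ and $\mathcal{N}^{j+1}$ is the linear span of $\mathcal{N}\,\mathcal{N}^j$. It is admissible if it is nilpotent and its annihilator $\mathrm{Ann}(\mathcal{N}):=\{u\in\mathcal{N}:u\,\mathcal{N}=0\}$ has dimension 1. An admissible projection on $\mathcal{N}$ is a linear projection $\pi:\mathcal{N}\to\mathrm{Ann}(\mathcal{N})$ with range $\mathrm{Ann}(\mathcal{N})$. Let $\mathcal{N}^0:=\mathbb{C}\oplus\mathcal{N}$ be the unital extension of $\mathcal{N}$, and extend $\pi$ to $\mathcal{N}^0$ linearly by $\pi(1)=0$. Let $Q'_\pi:=\{w\in 1+\mathcal{N}:\pi(w^2)=0\}$, an affine quadric in $1+\mathcal{N}$, and let $\log:1+\mathcal{N}\to\mathcal{N}$, $\log(1+u):=\sum_{m\ge1}\frac{(-1)^{m+1}}{m}u^m$, which is the inverse of the map $\exp:\mathcal{N}\to1+\mathcal{N}$, $\exp(u)=1+\sum_{m\ge1}\frac{u^m}{m!}$ (all sums are finite). Define $S_\pi:=\log(Q'_\pi)\subset\mathcal{N}$. Equivalently, $S_\pi=\{u\in\mathcal{N}:\pi(\exp_1(2u))=0\}$, where $\exp_1(u):=\sum_{m\ge1}\frac{u^m}{m!}$.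 *)

(* Defs.v *)
From HB Require Import structures.
From mathcomp Require Import all_boot all_order all_algebra.
From mathcomp Require Import boolp classical_sets fsbigop reals.
From mathcomp Require Import complex.

Set Implicit Arguments.
Unset Strict Implicit.
Unset Printing Implicit Defensive.

Import GRing.Theory.

Local Open Scope classical_set_scope.
Local Open Scope ring_scope.

(* MathComp's algebras are unital, so finite-dimensional commutative
   associative algebras without a unit are introduced here as vector spaces
   equipped with a bilinear multiplication. *)
HB.mixin Record Vector_isNonUnitalComAlgebra (K : fieldType) N
    of Vector K N := {
  nmul : N -> N -> N;
  nmulA : associative nmul;
  nmulC : commutative nmul;
  nmulDl : left_distributive nmul +%R;
  nmulZl : forall (c : K) (x y : N), nmul (c *: x) y = c *: nmul x y
}.

#[short(type="nonUnitalComAlgType")]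
HB.structure Definition NonUnitalComAlgebra (K : fieldType) :=
  {N of Vector K N & Vector_isNonUnitalComAlgebra K N}.

Declare Scope nonunital_scope.
Delimit Scope nonunital_scope with nu.
Notation "x ** y" := (nmul x y) (at level 40, left associativity)
  : nonunital_scope.
Local Open Scope nonunital_scope.

Section NonUnital.
Variables (K : fieldType) (N : nonUnitalComAlgType K).
Implicit Types (u v x y : N) (c : K).

Lemma nmulDr : right_distributive (@nmul K N) +%R.
Proof. by move=> x u v; rewrite nmulC nmulDl !(nmulC x). Qed.

Lemma nmulZr c x y : x ** (c *: y) = c *: (x ** y).
Proof. by rewrite nmulC nmulZl nmulC. Qed.

Lemma nmul_is_linear x : linear (@nmul K N x).
Proof. by move=> c u v; rewrite nmulDr nmulZr. Qed.
HB.instance Definition _ x :=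
  GRing.isLinear.Build K N N *:%R (@nmul K N x) (@nmul_is_linear x).

Lemma nmul0r x : x ** 0 = 0. Proof. exact: linear0. Qed.
Lemma nmul0l x : 0 ** x = 0. Proof. by rewrite nmulC nmul0r. Qed.

Definition nmul_hom x : 'End(N) := linfun (@nmul K N x).

Lemma nmul_hom_is_linear : linear nmul_hom.
Proof.
move=> c u v; apply/lfunP => x.
by rewrite add_lfunE scale_lfunE !lfunE /= nmulDl nmulZl.
Qed.
HB.instance Definition _ :=
  GRing.isLinear.Build K N 'End(N) *:%R nmul_hom nmul_hom_is_linear.

Definition annihilator : {vspace N} := lker (linfun nmul_hom).

Lemma annihilatorP u : reflect (forall v, u ** v = 0) (u \in annihilator).
Proof.
rewrite memv_ker lfunE; apply: (iffP eqP) => [u0 v | u0].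
  by have := congr1 (fun f : 'End(N) => f v) u0; rewrite !lfunE.
by apply/lfunP => v; rewrite !lfunE /= u0.
Qed.

Definition linear_span (A : set N) : set N :=
  [set u | exists (n : nat) (c : 'I_n -> K) (x : 'I_n -> N),
    (forall i, A (x i)) /\ u = \sum_(i < n) c i *: x i].

(* The index is shifted: [nideal_pow j] is the power N^(j+1) of the algebra. *)
Fixpoint nideal_pow (j : nat) : set N :=
  if j is j'.+1
  then linear_span [set w | exists x y, nideal_pow j' y /\ w = x ** y]
  else [set: N].

Definition nilpotent_alg : Prop :=
  exists nu : nat, nideal_pow nu = [set 0].

Definition admissible : Prop := nilpotent_alg /\ \dim annihilator = 1%N.

Definition admissible_projection (pi : 'End(N)) : Prop :=
  (pi \o pi)%VF = pi /\ limg pi = annihilator.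

Definition unitization : Type := (K^o * N)%type.

HB.instance Definition _ := Vector.copy unitization (K^o * N)%type.

Definition unitization_one : unitization := (1, 0).
Definition unitization_mul (w z : unitization) : unitization :=
  (w.1 * z.1, (w.1 : K) *: z.2 + (z.1 : K) *: w.2 + w.2 ** z.2).

Lemma unitization_mulA : associative unitization_mul.
Proof.
move=> [a u] [b v] [c w]; rewrite /unitization_mul /=; congr pair.
  by rewrite mulrA.
rewrite !scalerDr !scalerA !nmulDr !nmulDl !nmulZr !nmulZl nmulA.
rewrite (mulrC c a) (mulrC c b) -!addrA; do 2 congr (_ + _).
rewrite addrCA; congr (_ + _).
by rewrite [RHS]addrCA; congr (_ + _); rewrite [RHS]addrCA.
Qed.

Lemma unitization_mulC : commutative unitization_mul.
Proof.
move=> [a u] [b v]; rewrite /unitization_mul /=; congr pair.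
  by rewrite mulrC.
by rewrite nmulC [X in X + _]addrC.
Qed.

Lemma unitization_mul1 : left_id unitization_one unitization_mul.
Proof.
move=> [a u]; rewrite /unitization_mul /=.
by rewrite mul1r scale1r scaler0 nmul0l !addr0.
Qed.

Lemma unitization_mulDl : left_distributive unitization_mul +%R.
Proof.
move=> [a u] [b v] [c w]; rewrite /unitization_mul /=; congr pair.
  by rewrite mulrDl.
rewrite scalerDl scalerDr nmulDl.
by rewrite (addrACA (_ *: w)) [LHS]addrACA.
Qed.

Lemma unitization_one_neq0 : unitization_one != 0.
Proof.
by apply/eqP => /(congr1 fst) /eqP; apply/negP; exact: oner_neq0.
Qed.

HB.instance Definition _ := GRing.Zmodule_isComNzRing.Build unitization
  unitization_mulA unitization_mulC unitization_mul1 unitization_mulDl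
  unitization_one_neq0.

Lemma unitization_scaleAl (c : K) (w z : unitization) :
  c *: (w * z) = (c *: w) * z.
Proof.
case: w z => [a u] [b v]; apply: (congr2 pair) => /=; first exact: mulrA.
by rewrite !scalerDr !scalerA nmulZl (mulrC c b).
Qed.
HB.instance Definition _ :=
  GRing.Lmodule_isLalgebra.Build K unitization unitization_scaleAl.

Definition in_unitization u : unitization := (0, u).

Definition nil_part (w : unitization) : N := w.2.

(* The linear extension of pi to the unitization that vanishes at 1. *)
Definition extend_projection (pi : 'End(N)) (w : unitization) : N :=
  pi (nil_part w).

Definition one_plus : set unitization := [set 1 + in_unitization u | u in setT].

Definition quadric (pi : 'End(N)) : set unitization :=
  [set w | one_plus w /\ extend_projection pi (w ^+ 2) = 0].

(* Only meaningful on [one_plus] when [N] is nilpotent. There w - 1 lies in N,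
   so do its positive powers, and the sum over all m > 0 has finite support;
   [nil_part] merely regards these powers as elements of N. *)
Definition nlog (w : unitization) : N :=
  \sum_(m \in [set m : nat | (0 < m)%N])
    ((-1) ^+ m.+1 / m%:R : K) *: nil_part ((w - 1) ^+ m).

Definition log_quadric (pi : 'End(N)) : set N := nlog @` quadric pi.

End NonUnital.

(* Main.v *)
Require Import Defs.
From HB Require Import structures.
From mathcomp Require Import all_boot all_order all_algebra.
From mathcomp Require Import boolp classical_sets fsbigop reals.
From mathcomp Require Import complex.
From mathcomp Require Import ring.

(** Write A for the unitization of N. Composed with a coordinate on the line
    Ann(N), the extension of pi to A is a linear form l, and (w, z) |-> l(w z)
    is a nondegenerate bilinear form: its radical is an ideal of A, every
    nonzero ideal of A meets Ann(N) nontrivially, and pi is the identity on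
    Ann(N). Since A is finite-dimensional, the extension of pi' is therefore
    w |-> pi(g w) for some g in A, and comparing the two projections on Ann(N)
    shows that g lies in 1 + N ([admissible_projection_twist]).

    A unipotent element has a unipotent square root, say g = h^2
    ([one_plus_sqrt]). Then pi'(w^2) = pi((h w)^2), so multiplication by h maps
    the quadric of pi' bijectively onto the quadric of pi. The logarithm turns
    this multiplication into a translation ([nlogM]), and the claim holds with
    a = - log h.

    The functional equation of the logarithm is proved for nilpotent x, y in a
    commutative ring where the coefficients (-1)^m / (m + 1) make sense. The
    difference log ((1 + x t) (1 + y t)) - log (1 + x t) - log (1 + y t) is a
    polynomial in t; it vanishes at t = 0, and its derivative vanishes because
    the logarithmic derivative of a product is the sum of those of its factors
    ([log_seriesM]). *)

Set Implicit Arguments.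
Unset Strict Implicit.
Unset Printing Implicit Defensive.

Import GRing.Theory Num.Theory.

Local Open Scope classical_set_scope.
Local Open Scope ring_scope.
Local Open Scope nonunital_scope.

(** * Unipotent elements of a commutative ring *)

Lemma geom_unipotent (A : comNzRingType) (x : A) n : x ^+ n = 0 ->
  (1 + x) * \sum_(m < n) (- x) ^+ m = 1.
Proof.
move=> xn0; have := subrX1 (- x) n; rewrite exprNn xn0 mulr0 sub0r => eqS.
by apply: oppr_inj; rewrite eqS -mulNr opprD addrC.
Qed.

Lemma nilpotent_mul1p_sub1 (A : comNzRingType) (x y : A) n :
  x ^+ n = 0 -> y ^+ n = 0 -> ((1 + x) * (1 + y) - 1) ^+ (n + n) = 0.
Proof.
move=> xn0 yn0; have -> : (1 + x) * (1 + y) - 1 = x + y * (1 + x) by ring.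
rewrite exprDn big1 // => i _.
have [le_ni|lt_in] := leqP n i.
  by rewrite exprMn -(subnK le_ni) (exprD y) yn0 mulr0 mul0r mulr0 mul0rn.
have le_n : (n <= n + n - i)%N by rewrite -addnBA ?leq_addr // ltnW.
by rewrite -(subnK le_n) exprD xn0 mulr0 mul0r mul0rn.
Qed.

(** A simplified Newton iteration for the square root of 1 + u, gaining one
    power of u per step. The approximation is kept in the form 1 + u q so that, when u lies in an ideal, the root stays
    congruent to 1 modulo that ideal. *)
Lemma unipotent_sqrt_approx (A : comNzRingType) (half u : A) n :
  half *+ 2 = 1 ->
  exists q r : A, (1 + u * q) ^+ 2 = 1 + u + u ^+ n.+1 * r.
Proof.
move=> half2; elim: n => [|n [q [r eq_n]]].
  by exists 0, (-1); rewrite expr1; ring.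
(* Subtracting half of the error u^(n+1) r, written here as u e, cancels it up
   to terms with one more factor u. *)
pose e := half * u ^+ n * r; exists (q - e).
exists (- q * r + half ^+ 2 * u ^+ n * r ^+ 2).
have -> : (1 + u * (q - e)) ^+ 2 =
  (1 + u * q) ^+ 2 - half *+ 2 * (1 + u * q) * (u ^+ n.+1 * r) + (u * e) ^+ 2.
  by rewrite /e (exprS u n); ring.
by rewrite eq_n half2 /e (exprS u n.+1) (exprS u n); ring.
Qed.

(** * The truncated logarithm and its functional equation *)

Section TruncatedLog.

(** This is log (1 + x) once x is nilpotent of order at most n.+1 and
    c m = (-1)^m / (m + 1). The coefficients are an argument so that the same
    series can be formed in a polynomial ring over A. *)
Definition log_series (A : comNzRingType) (c : nat -> A) n x : A :=
  \sum_(m < n) c m * x ^+ m.+1.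

Lemma rmorph_log_series (A B : comNzRingType) (f : {rmorphism A -> B})
    (c : nat -> A) n x :
  f (log_series c n x) = log_series (f \o c) n (f x).
Proof.
by rewrite rmorph_sum; apply: eq_bigr => m _; rewrite rmorphM rmorphXn.
Qed.

Variables (A : comNzRingType) (c : nat -> A).
Hypothesis c_log : forall m, c m *+ m.+1 = (-1) ^+ m.

(** The coefficients of the logarithm can only exist in a ring without integer
    torsion: up to sign, c m is an inverse of m + 1. *)
Lemma log_coef_mulrnI (a : A) m : a *+ m.+1 = 0 -> a = 0.
Proof.
move=> am0; have : (-1) ^+ m * (c m * (a *+ m.+1)) = a.
  by rewrite mulrnAr -mulrnAl c_log mulrA -exprMn mulrNN mulr1 expr1n mul1r.
by rewrite am0 !mulr0.
Qed.

Lemma deriv_eq0_const (p : {poly A}) : p^`() = 0 -> p = (p`_0)%:P.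
Proof.
move=> dp0; apply/polyP => -[|i]; rewrite coefC //=.
by apply: (@log_coef_mulrnI _ i); rewrite -coef_deriv dp0 coef0.
Qed.

(** The identity (log (1 + p))' = p' / (1 + p), cleared of its denominator:
    termwise differentiation yields the geometric series. *)
Lemma deriv_log_series n (p : {poly A}) : p ^+ n = 0 ->
  (1 + p) * (log_series (polyC \o c) n p)^`() = p^`().
Proof.
move=> pn0; rewrite raddf_sum /=.
rewrite (eq_bigr (fun m : 'I_n => p^`() * (- p) ^+ m)) => [|m _].
  by rewrite -mulr_sumr mulrCA geom_unipotent ?mulr1.
rewrite derivM derivC mul0r add0r deriv_exp /= mulrnAr -mulrnAl.
by rewrite -polyCMn c_log mulrCA (exprNn p) rmorphXn rmorphN1.
Qed.

(** Truncation at n + n rather than n: the argument of the left-hand side is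
    only known to be nilpotent of order n + n. *)
Lemma log_seriesM n (x y : A) : x ^+ n = 0 -> y ^+ n = 0 ->
  log_series c (n + n) ((1 + x) * (1 + y) - 1) =
  log_series c (n + n) x + log_series c (n + n) y.
Proof.
move=> xn0 yn0; pose L := log_series (polyC \o c) (n + n).
pose p : {poly A} := x *: 'X; pose q : {poly A} := y *: 'X.
pose r := (1 + p) * (1 + q) - 1.
have pn0 : p ^+ n = 0 by rewrite exprZn xn0 scale0r.
have qn0 : q ^+ n = 0 by rewrite exprZn yn0 scale0r.
have p2n0 : p ^+ (n + n) = 0 by rewrite exprD pn0 mul0r.
have q2n0 : q ^+ (n + n) = 0 by rewrite exprD qn0 mul0r.
have r2n0 : r ^+ (n + n) = 0 by exact: nilpotent_mul1p_sub1.
pose D := L r - (L p + L q).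
have D_const : D = (D`_0)%:P.
  (* As 1 + r is a unit, it suffices to compare after multiplying by it. *)
  apply: deriv_eq0_const; rewrite -[LHS]mul1r -(geom_unipotent r2n0) mulrAC.
  suff -> : (1 + r) * D^`() = 0 by rewrite mul0r.
  rewrite derivB derivD mulrBr deriv_log_series // mulrDr.
  have -> : 1 + r = (1 + p) * (1 + q) by rewrite addrC subrK.
  rewrite [_ * _ * (L p)^`()]mulrAC -[_ * _ * (L q)^`()]mulrA.
  rewrite !deriv_log_series //.
  by rewrite derivB derivM !derivD -polyC1 derivC !add0r subr0 subrr.
have L_eval t s : (L s).[t] = log_series c (n + n) s.[t].
  rewrite -horner_evalE rmorph_log_series; congr (log_series _ _ _).
  by apply/funext => m /=; rewrite horner_evalE hornerC.
have r_eval t : r.[t] = (1 + x * t) * (1 + y * t) - 1.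
  by rewrite /r /p /q !hornerE.
have D_eval t : D.[t] = log_series c (n + n) ((1 + x * t) * (1 + y * t) - 1)
    - (log_series c (n + n) (x * t) + log_series c (n + n) (y * t)).
  by rewrite hornerD hornerN hornerD !L_eval r_eval /p /q !hornerE.
have log0 : log_series c (n + n) 0 = 0.
  by apply: big1 => m _; rewrite expr0n mulr0.
apply/eqP; rewrite -subr_eq0; apply/eqP.
have := D_eval 1; rewrite !mulr1 => <-.
have : D.[0] = 0 by rewrite D_eval !mulr0 addr0 mulr1 subrr log0 !addr0 subr0.
by rewrite D_const !hornerC.
Qed.

End TruncatedLog.

(** * Nondegenerate bilinear forms *)

(** An injective map from V to its dual is onto, by equality of dimensions. *)
Lemma nondegenerate_represents (K : fieldType) (V : vectType K)
    (B : {linear V -> 'Hom(V, K^o)}) :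
  (forall g, B g = 0 -> g = 0) -> forall f, exists g, B g = f.
Proof.
move=> B_inj f; have kerB : lker (linfun B) == 0%VS.
  by apply/lker0P => x y; rewrite !lfunE /= => /eqP;
    rewrite -subr_eq0 -linearB => /eqP /B_inj /eqP; rewrite subr_eq0 => /eqP.
have : f \in limg (linfun B).
  suff -> : limg (linfun B) = fullv by rewrite memvf.
  apply/eqP; rewrite eqEdim subvf /= limg_dim_eq ?(eqP kerB) ?capv0 //.
  by rewrite !dimvf /dim /= muln1.
by case/memv_imgP => g _ ->; exists g; rewrite lfunE.
Qed.

(** * The unitization of a nilpotent algebra *)

Section Unitization.
Variables (K : numFieldType) (N : nonUnitalComAlgType K).
Implicit Types (w z : unitization N) (u v : N).

Lemma one_plusE w : one_plus w <-> w.1 = 1.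
Proof.
split=> [[u _ <-]|w1]; first by rewrite /= addr0.
exists w.2 => //; case: w w1 => a v /= ->.
by congr pair; rewrite ?addr0 ?add0r.
Qed.

Lemma in_unitizationM u v :
  in_unitization u * in_unitization v = in_unitization (u ** v).
Proof. by congr pair; rewrite /= ?mulr0 // !scale0r !add0r. Qed.

Lemma nideal_pow_mul j u v : nideal_pow j u -> nideal_pow j.+1 (u ** v).
Proof.
move=> Nu; exists 1%N, (fun=> 1), (fun=> u ** v); split.
  by move=> _; exists v, u; rewrite nmulC.
by rewrite big_ord1 scale1r.
Qed.

Lemma nideal_pow_exp u j :
  exists2 v, in_unitization u ^+ j.+1 = in_unitization v & nideal_pow j v.
Proof.
elim: j => [|j [v eq_v Nv]]; first by exists u.
exists (v ** u); last exact: nideal_pow_mul.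
by rewrite exprSr eq_v in_unitizationM.
Qed.

Lemma nilpotent_alg_exp : nilpotent_alg N ->
  exists n, forall w, w.1 = 0 -> w ^+ n = 0.
Proof.
case=> nu N0; exists nu.+1 => -[a u] /= ->.
by have [v -> Nv] := nideal_pow_exp u nu; move: Nv; rewrite N0 => ->.
Qed.

(** Every nonzero element of N has a nonzero multiple in the annihilator: keep
    multiplying by elements of N as long as the product is nonzero; since the
    product moves down the powers of N, this stops. *)
Lemma annihilator_multiple u : nilpotent_alg N -> u != 0 ->
  exists z v, [/\ in_unitization u * z = in_unitization v,
                 v \in annihilator N & v != 0].
Proof.
case=> nu N0.
(* Induction on the distance k from the vanishing power of N. *)
suff: forall k u, nideal_pow (nu - k) u -> u != 0 ->
    exists z v, [/\ in_unitization u * z = in_unitization v,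
                   v \in annihilator N & v != 0].
  by move=> /(_ nu u); rewrite subnn; apply.
elim=> [|k IHk] {}u Nu u0.
  by move: Nu u0; rewrite subn0 N0 => ->; rewrite eqxx.
have [annu|/existsNP[v /eqP uv0]] := pselect (forall v, u ** v = 0).
  by exists 1, u; rewrite mulr1; split=> //; exact/annihilatorP.
have Nuv : nideal_pow (nu - k) (u ** v).
  have [lt_k|le_k] := ltnP k nu.
    by rewrite -subSS subSn //; exact: nideal_pow_mul.
  (* Here the truncated difference is 0, and the zeroth power is all of N. *)
  by move: (le_k); rewrite -subn_eq0 => /eqP->; exact: I.
have [z [t [eq_t annt t0]]] := IHk _ Nuv uv0.
by exists (in_unitization v * z), t; rewrite mulrA in_unitizationM.
Qed.

Definition log_coef (m : nat) : unitization N :=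
  ((-1) ^+ m / m.+1%:R : K) *: 1.

Lemma log_coefE m : log_coef m *+ m.+1 = (-1) ^+ m.
Proof.
rewrite -scaler_nat scalerA mulrCA divff ?pnatr_eq0 // mulr1.
rewrite -signr_odd -[RHS]signr_odd.
by case: odd; rewrite ?expr1 ?scaleN1r ?expr0 ?scale1r.
Qed.

(** Nilpotency cuts the sum over all m > 0 down to m <= n; its index is shifted
    to start at 0. *)
Lemma nlogE n w : (w - 1) ^+ n = 0 ->
  nlog w = nil_part (log_series log_coef n (w - 1)).
Proof.
move=> wn0; rewrite /nlog -(@fsbig_widen _ _ _ _ [set` index_iota 1 n.+1]).
- rewrite -fsbig_seq ?iota_uniq // big_add1 big_mkord.
  rewrite /log_series /nil_part [RHS](raddf_sum (snd : unitization N -> N)).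
  apply: eq_bigr => m _; rewrite -scalerAl mul1r.
  by rewrite !exprS !mulN1r opprK.
- by move=> m /=; rewrite mem_index_iota => /andP[].
- move=> m /= [m0]; rewrite mem_index_iota m0 ltnS => /negP.
  rewrite -ltnNge => /ltnW le_nm.
  by rewrite -(subnK le_nm) exprD wn0 mulr0 scaler0.
Qed.

Lemma nlogM w z : nilpotent_alg N -> one_plus w -> one_plus z ->
  nlog (w * z) = nlog w + nlog z.
Proof.
move=> /nilpotent_alg_exp[n Nn] /one_plusE w1 /one_plusE z1.
have wn : (w - 1) ^+ n = 0 by apply: Nn; rewrite /= w1 subrr.
have zn : (z - 1) ^+ n = 0 by apply: Nn; rewrite /= z1 subrr.
have wzn : (w * z - 1) ^+ n = 0 by apply: Nn; rewrite /= w1 z1 mulr1 subrr.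
rewrite !(@nlogE (n + n)) ?exprD ?wn ?zn ?wzn ?mul0r //.
have := log_seriesM log_coefE wn zn; rewrite !(addrC 1) !subrK.
by move=> ->.
Qed.

Lemma one_plus_sqrt w : nilpotent_alg N -> one_plus w ->
  exists2 h, one_plus h & h ^+ 2 = w.
Proof.
move=> /nilpotent_alg_exp[n Nn] /one_plusE w1.
have half2 : ((2%:R^-1 : K) *: (1 : unitization N)) *+ 2 = 1.
  by rewrite -scaler_nat scalerA divff ?pnatr_eq0 // scale1r.
have [q [r]] := unipotent_sqrt_approx (w - 1) n half2.
rewrite (exprS (w - 1)) Nn /= ?w1 ?subrr // mulr0 mul0r addr0.
rewrite (addrC 1 (w - 1)) subrK.
exists (1 + (w - 1) * q) => //.
by apply/one_plusE; rewrite /= w1 subrr mul0r addr0.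
Qed.

Lemma one_plus_inv w : nilpotent_alg N -> one_plus w ->
  exists2 z, one_plus z & w * z = 1.
Proof.
move=> /nilpotent_alg_exp[n Nn] /one_plusE w1.
have wn : (w - 1) ^+ n = 0 by apply: Nn; rewrite /= w1 subrr.
have := geom_unipotent wn; rewrite (addrC 1) subrK.
set z := \sum_(m < n) _ => wz1; exists z => //; apply/one_plusE.
by have := congr1 fst wz1; rewrite /= w1 mul1r.
Qed.

Lemma one_plusM w z : one_plus w -> one_plus z -> one_plus (w * z).
Proof.
by move=> /one_plusE w1 /one_plusE z1; apply/one_plusE; rewrite /= w1 z1 mulr1.
Qed.

(** * Admissible projections and the translation *)

Lemma admissible_projection_id (pi : 'End(N)) u :
  admissible_projection pi -> u \in annihilator N -> pi u = u.
Proof.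
case=> pipi <- /memv_imgP[v _ ->].
by rewrite -[LHS](comp_lfunE pi pi) pipi.
Qed.

Lemma admissible_projection_annihilator (pi : 'End(N)) u :
  admissible_projection pi -> pi u \in annihilator N.
Proof. by case=> _ <-; exact: memv_img (memvf u). Qed.

Section TraceForm.
Variable l : 'Hom(N, K^o).

Definition trace_form_fun w z : K^o := l (nil_part (w * z)).

Lemma trace_form_fun_linear w : linear (trace_form_fun w).
Proof.
move=> a x y; rewrite /trace_form_fun mulrC mulrDl -scalerAl !(mulrC _ w).
exact: linearP.
Qed.
HB.instance Definition _ w := GRing.isLinear.Build K (unitization N) K^o *:%R
  (trace_form_fun w) (trace_form_fun_linear w).

Definition trace_form w : 'Hom(unitization N, K^o) := linfun (trace_form_fun w).

Lemma trace_form_linear : linear trace_form.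
Proof.
move=> a x y; apply/lfunP => z.
rewrite add_lfunE scale_lfunE !lfunE /= /trace_form_fun mulrDl -scalerAl.
exact: linearP.
Qed.
HB.instance Definition _ := GRing.isLinear.Build K (unitization N)
  'Hom(unitization N, K^o) *:%R trace_form trace_form_linear.

(** The radical of the form is an ideal on which l vanishes, and l is injective
    on the annihilator. An element of the radical with nonzero scalar part
    would multiply the annihilator into itself by a nonzero scalar; a nonzero
    element of N has a nonzero multiple in the annihilator. *)
Lemma trace_form_inj : nilpotent_alg N -> annihilator N != 0%VS ->
  (forall u, u \in annihilator N -> l u = 0 -> u = 0) ->
  forall w, trace_form w = 0 -> w = 0.
Proof.
move=> nilN ann0 l_inj w w0.
have {}w0 z : l (nil_part (w * z)) = 0.
  by have := congr1 (fun f : 'Hom(_, _) => f z) w0; rewrite !lfunE.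
have fst0 : w.1 = 0.
  pose s := vpick (annihilator N).
  have ann_s : s \in annihilator N by exact: memv_pick.
  have := w0 (in_unitization s).
  rewrite /nil_part /= scale0r addr0 (nmulC w.2) (annihilatorP _ ann_s) addr0.
  move=> /l_inj; rewrite memvZ // => /(_ isT) /eqP.
  by rewrite scaler_eq0 vpick0 (negPf ann0) orbF => /eqP.
have w_in : w = in_unitization w.2 by case: (w) fst0 => a v /= ->.
rewrite w_in; apply/eqP; have [->//|w20] := eqVneq w.2 0.
have [z [v [eq_v annv]]] := annihilator_multiple nilN w20.
by have := w0 z; rewrite {1}w_in eq_v => /(l_inj _ annv) ->; rewrite eqxx.
Qed.

End TraceForm.

(** The unit g represents the functional pi' with respect to the form of pi. On
    the annihilator, g acts by its scalar part, while both projections are the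
    identity there; hence the scalar part is 1. *)
Lemma admissible_projection_twist (pi pi' : 'End(N)) : admissible N ->
  admissible_projection pi -> admissible_projection pi' ->
  exists2 g, one_plus g &
    forall w, extend_projection pi' w = extend_projection pi (g * w).
Proof.
move=> [nilN dim1] pr pr'.
pose s := vpick (annihilator N).
have ann0 : annihilator N != 0%VS by rewrite -dimv_eq0 dim1.
have s0 : s != 0 by rewrite vpick0.
have ann_s : s \in annihilator N by exact: memv_pick.
have annE : annihilator N = <[s]>%VS.
  by apply/esym/eqP; rewrite eqEdim dim_vline s0 dim1 -memvE ann_s.
pose l : 'Hom(N, K^o) := linfun (coord [tuple s] 0 : N -> K^o).
have ls : l s = 1.
  have free_s : free [tuple s] by rewrite seq1_free.
  by rewrite lfunE; exact: (coord_free 0 0 free_s).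
have lE u : u \in annihilator N -> u = l u *: s.
  rewrite annE => /vlineP[k ->]; congr (_ *: _).
  have -> : l (k *: s) = k * l s by exact: linearZ.
  by rewrite ls mulr1.
have l_inj u : u \in annihilator N -> l u = 0 -> u = 0.
  by move=> /lE {2}-> ->; rewrite scale0r.
pose lpi := (l \o pi)%VF.
have lpi_inj u : u \in annihilator N -> lpi u = 0 -> u = 0.
  move=> annu; rewrite comp_lfunE (admissible_projection_id pr annu).
  exact: l_inj.
pose ext' : 'Hom(unitization N, K^o) :=
  linfun (l \o pi' \o (snd : unitization N -> N)).
have [g g_ext] :=
  nondegenerate_represents (trace_form_inj nilN ann0 lpi_inj) ext'.
have pi_g w : extend_projection pi' w = extend_projection pi (g * w).
  have := congr1 (fun f : 'Hom(_, _) => f w) g_ext.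
  rewrite !lfunE /= /trace_form_fun comp_lfunE => eq_l.
  rewrite /extend_projection (lE _ (admissible_projection_annihilator _ pr)).
  by rewrite eq_l -lE //; exact: admissible_projection_annihilator.
exists g => //; apply/one_plusE.
have := pi_g (in_unitization s); rewrite /extend_projection /nil_part /=.
rewrite scale0r addr0 (nmulC g.2) (annihilatorP _ ann_s) addr0 linearZ /=.
rewrite !admissible_projection_id // => /eqP.
rewrite -[X in X == _]scale1r -subr_eq0 -scalerBl scaler_eq0 (negPf s0) orbF.
by rewrite subr_eq0 => /eqP.
Qed.

End Unitization.

Theorem log_quadric_translate (K : numFieldType) (N : nonUnitalComAlgType K)
    (pi pi' : 'End(N)) :
  admissible N -> admissible_projection pi -> admissible_projection pi' ->
  exists a : N, log_quadric pi' = [set u + a | u in log_quadric pi].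
Proof.
move=> admN pr pr'; have nilN := admN.1.
have [g g1 pi_g] := admissible_projection_twist admN pr pr'.
have [h h1 h2] := one_plus_sqrt nilN g1.
have [k k1 hk] := one_plus_inv nilN h1.
have quadricE w : one_plus w -> quadric pi' w <-> quadric pi (h * w).
  move=> w1; rewrite /quadric /= pi_g -h2 -exprMn.
  by split=> -[_ ?]; split=> //; exact: one_plusM.
(* quadricE says that w lies in the quadric of pi' iff h w lies in that of pi;
   the two inclusions use w |-> h w and its inverse w |-> k w. *)
exists (- nlog h); apply/seteqP; split=> u.
  case=> w Qw <-; exists (nlog (h * w)).
    by exists (h * w) => //; apply/quadricE => //; case: Qw.
  by rewrite nlogM ?addrK 1?addrC ?addKr //; case: Qw.
case=> _ [w Qw <-] <-; have w1 := Qw.1.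
have hkw : h * (k * w) = w by rewrite mulrA hk mul1r.
have kw1 : one_plus (k * w) by exact: one_plusM.
exists (k * w); first by apply/quadricE; rewrite ?hkw.
by rewrite /= -[in RHS]hkw (nlogM nilN h1 kw1) addrAC subrr add0r.
Qed.

Theorem proposition2p2 (R : realType) (N : nonUnitalComAlgType R[i])
    (pi pi' : 'End(N)) :
  admissible N -> admissible_projection pi -> admissible_projection pi' ->
  exists a : N, log_quadric pi' = [set u + a | u in log_quadric pi].
Proof. exact: log_quadric_translate. Qed.
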